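(* Let $G$ be a countable directed graph which has no sinks or has no sources. If $\mathcal{A}$ is any Banach algebra and $\phi:\mathcal{A}\to\mathcal{T}_+(G)$ is a surjective algebra homomorphism, then $\phi$ is (automatically) norm-continuous.
   Context: A countable directed graph $G$ has countable vertex set $\mathcal{V}(G)$, countable edge set $\mathcal{E}(G)$, and range and source maps $r,s$. A vertex is a sink if it is the source of no edge and a source if it is the range of no edge. The free semigroupoid $\mathbb{F}^+(G)$ consists of vertices (paths of length $0$) and finite paths $w=e_k\cdots e_1$ with $s(e_i)=r(e_{i-1})$, $s(w)=s(e_1)$, $r(w)=r(e_k)$. On $\ell^2(\mathbb{F}^+(G))$ with orthonormal basis $\{\xi_w\}$, $L_e\xi_w=\xi_{ew}$ if $s(e)=r(w)$ and $0$ otherwise, and $P_v$ is the projection onto $\overline{\operatorname{span}}\{\xi_w:r(w)=v\}$. The tensor algebra $\mathcal{T}_+(G)$ is the norm-closed operator algebra generated by all $L_e$ and $P_v$. *)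

(* Defs.v *)
From HB Require Import structures.
From mathcomp Require Import all_boot all_order all_algebra.
From mathcomp Require Import all_classical all_reals all_analysis.
From mathcomp Require Import complex.

Set Implicit Arguments.
Unset Strict Implicit.
Unset Printing Implicit Defensive.

Import Order.TTheory GRing.Theory Num.Theory.
Local Open Scope ring_scope.
Local Open Scope classical_set_scope.

Definition cmod (R : realType) (z : R[i]) : R := ComplexField.Normc.normc z.

Record banach_algebra (R : realType) (A : lmodType R[i])
    (mul : A -> A -> A) (nrm : A -> R) : Prop := {
  ba_mulA : forall a b c, mul a (mul b c) = mul (mul a b) c;
  ba_mulDl : forall a b c, mul (a + b) c = mul a c + mul b c;
  ba_mulDr : forall a b c, mul a (b + c) = mul a b + mul a c;
  ba_mulZl : forall (k : R[i]) a b, mul (k *: a) b = k *: mul a b;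
  ba_mulZr : forall (k : R[i]) a b, mul a (k *: b) = k *: mul a b;
  ba_nrmD : forall a b, nrm (a + b) <= nrm a + nrm b;
  ba_nrmZ : forall (k : R[i]) a, nrm (k *: a) = cmod k * nrm a;
  ba_nrm_eq0 : forall a, nrm a = 0 -> a = 0;
  ba_nrmM : forall a b, nrm (mul a b) <= nrm a * nrm b;
  ba_complete : forall u : nat -> A,
    (forall eps : R, 0 < eps -> exists N : nat, forall m n : nat,
        (N <= m)%N -> (N <= n)%N -> nrm (u m - u n) < eps) ->
    exists l : A, forall eps : R, 0 < eps -> exists N : nat, forall n : nat,
        (N <= n)%N -> nrm (u n - l) < eps
}.

Section TensorAlgebra.
Variables (R : realType) (V E : countType) (r s : E -> V).
Local Notation C := R[i].

(* A raw path is a pair (v, [:: e_k; ...; e_1]); it is a genuine path of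
   F^+(G) when v = r(w) and s(e_i) = r(e_{i-1}).  (v, [::]) is the vertex v. *)
Definition rawpath := (V * seq E)%type.

Fixpoint valid_edges (v : V) (es : seq E) : bool :=
  match es with
  | [::] => true
  | e :: es' => (r e == v) && valid_edges (s e) es'
  end.

Definition is_path (w : rawpath) : bool := valid_edges w.1 w.2.

Definition vec := rawpath -> C.
Definition op := vec -> vec.

Definition l2sq (x : vec) : \bar R :=
  \esum_(w in [set: rawpath]) ((cmod (x w)) ^+ 2)%:E.

Definition in_l2 (x : vec) : Prop :=
  (forall w, ~~ is_path w -> x w = 0) /\ (l2sq x < +oo)%E.

Definition l2norm (x : vec) : R := Num.sqrt (fine (l2sq x)).

(* L_e xi_w = xi_{ew} if s(e) = r(w), 0 otherwise *)
Definition Lop (e : E) : op := fun x w =>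
  match w.2 with
  | e' :: es => if (e' == e) && (w.1 == r e) then x (s e, es) else 0
  | [::] => 0
  end.

Definition Pop (v : V) : op := fun x w => if w.1 == v then x w else 0.

Inductive in_alg : op -> Prop :=
| alg_zero : in_alg (fun _ _ => 0)
| alg_L e : in_alg (Lop e)
| alg_P v : in_alg (Pop v)
| alg_add T S : in_alg T -> in_alg S -> in_alg (fun x w => T x w + S x w)
| alg_scale (c : C) T : in_alg T -> in_alg (fun x w => c * T x w)
| alg_mul T S : in_alg T -> in_alg S -> in_alg (fun x => T (S x)).

Definition bounded_op (T : op) : Prop :=
  (forall x, in_l2 x -> in_l2 (T x)) /\
  (forall (c : C) x y, in_l2 x -> in_l2 y ->
      T (fun w => c * x w + y w) = (fun w => c * T x w + T y w)) /\
  (exists M : R, forall x, in_l2 x -> l2norm (T x) <= M * l2norm x).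

Definition opnorm (T : op) : R :=
  sup [set l2norm (T x) | x in [set x | in_l2 x /\ l2norm x <= 1]].

Definition opsub (T S : op) : op := fun x w => T x w - S x w.

Definition in_Tplus (T : op) : Prop :=
  bounded_op T /\
  forall eps : R, 0 < eps -> exists S, in_alg S /\ opnorm (opsub T S) < eps.

Definition no_sinks : Prop := forall v : V, exists e : E, s e = v.
Definition no_sources : Prop := forall v : V, exists e : E, r e = v.

End TensorAlgebra.

Definition alg_hom_op (R : realType) (V E : countType) (r s : E -> V)
    (A : lmodType R[i]) (mul : A -> A -> A) (phi : A -> op R V E) : Prop :=
  forall (a b : A) (k : R[i]) (x : vec R V E), in_l2 r s x ->
    phi (a + b) x = (fun w => phi a x w + phi b x w) /\
    phi (k *: a) x = (fun w => k * phi a x w) /\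
    phi (mul a b) x = phi a (phi b x).

Definition onto_Tplus (R : realType) (V E : countType) (r s : E -> V)
    (A : Type) (phi : A -> op R V E) : Prop :=
  (forall a, in_Tplus r s (phi a)) /\
  (forall T, in_Tplus r s T -> exists a, forall x, in_l2 r s x -> phi a x = T x).

(* Main.v *)
Require Import Defs.
From HB Require Import structures.
From mathcomp Require Import all_boot all_order all_algebra.
From mathcomp Require Import all_classical all_reals all_analysis.
From mathcomp Require Import complex ring lra zify.
Import Order.TTheory GRing.Theory Num.Theory.
Local Open Scope ring_scope.
Local Open Scope classical_set_scope.

(** Let W = sum_e om_e L_e be an element of T_+(G) with all weights nonzero, and
    lift a small multiple of it to b with |b| <= 1.  Without sinks every path w
    is the tail of a path p w with |p| = n, and the coefficient of W^n y at p w
    is a nonzero multiple of the coefficient of y at w, whereas W^m y has no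
    coefficient on paths shorter than m.  If a |-> <phi(a) x, xi_w> were
    unbounded, small a_n could be chosen such that the coefficients of
    phi(sum_n b^(nK) a_n) x at the paths p_n w are unbounded, which is absurd.
    Without sources the same works with powers of b on the right, x = xi_v, and
    coefficients at paths w p; since phi(a) commutes with deleting initial
    segments, this passes from vertices v to all paths, and hence to all x
    because only the finitely many tails of w contribute to <phi(a) x, xi_w>.
    Once all coefficients are bounded functionals on A, uniform boundedness
    gives the continuity of phi. *)

(** * The modulus of complex numbers *)

Section Modulus.
Context {R : realType}.
Implicit Types (z w : R[i]) (t : R).

Lemma cmodM z w : cmod (z * w) = cmod z * cmod w.
Proof. exact: ComplexField.Normc.normcM. Qed.

Lemma cmodD z w : cmod (z + w) <= cmod z + cmod w.
Proof. exact: le_normcD. Qed.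

Lemma cmod0 : cmod (0 : R[i]) = 0.
Proof. exact: ComplexField.Normc.normc0. Qed.

Lemma cmodN z : cmod (- z) = cmod z.
Proof. exact: normcN. Qed.

Lemma cmodB z w : cmod (z - w) = cmod (w - z).
Proof. by rewrite -cmodN opprB. Qed.

Lemma cmod_ge0 z : 0 <= cmod z.
Proof. by rewrite /cmod /ComplexField.Normc.normc; case: z => a b; exact: sqrtr_ge0. Qed.

Lemma cmod_eq0 z : cmod z = 0 -> z = 0.
Proof. exact: ComplexField.Normc.eq0_normc. Qed.

Lemma cmod_real t : cmod t%:C%C = `|t|.
Proof. by rewrite /cmod /= expr0n /= addr0 sqrtr_sqr. Qed.

Lemma cmod1 : cmod (1 : R[i]) = 1.
Proof. exact: ComplexField.Normc.normc1. Qed.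

End Modulus.

(** * Twisted series and gliding humps in a Banach algebra *)

Section BanachAlgebra.
Context {R : realType} {A : lmodType R[i]} {mul : A -> A -> A} {nrm : A -> R}.
Hypothesis HA : banach_algebra mul nrm.

Lemma nrm0 : nrm 0 = 0.
Proof. by rewrite -(scale0r 0) (ba_nrmZ HA) cmod0 mul0r. Qed.

Lemma nrmN a : nrm (- a) = nrm a.
Proof. by rewrite -scaleN1r (ba_nrmZ HA) cmodN cmod1 mul1r. Qed.

Lemma nrmB a b : nrm (a - b) = nrm (b - a).
Proof. by rewrite -nrmN opprB. Qed.

(** Positivity is not a field of [banach_algebra]; it comes from 0 = |a - a| <= 2|a|. *)
Lemma nrm_ge0 a : 0 <= nrm a.
Proof. by have := ba_nrmD HA a (- a); rewrite subrr nrm0 nrmN; lra. Qed.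

Lemma nrm_small_eq0 a : (forall eps, 0 < eps -> nrm a < eps) -> a = 0.
Proof.
move=> h; apply: (ba_nrm_eq0 HA); apply/eqP; rewrite eq_le nrm_ge0 andbT.
by apply/ler_addgt0Pr => e e0; rewrite add0r ltW// h.
Qed.

Section Glide.
Variable sigma : A -> A.
Hypothesis sigmaD : forall a b, sigma (a + b) = sigma a + sigma b.
Hypothesis sigma_contr : forall a, nrm (sigma a) <= nrm a.

Let sigmaB a b : sigma (a - b) = sigma a - sigma b.
Proof. by apply: (addIr (sigma b)); rewrite -sigmaD !subrK. Qed.

Let iter_sigmaD n a b : iter n sigma (a + b) = iter n sigma a + iter n sigma b.
Proof. by elim: n => //= n ->; rewrite sigmaD. Qed.

(* [X n] is the twisted tail [a n + sigma (a n.+1 + sigma (a n.+2 + ...))]. *)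
Lemma twisted_series (a : nat -> A) (D : nat -> R) :
  (forall n, 0 < D n) -> (forall n, D n.+1 <= D n / 2) ->
  (forall n, nrm (a n) <= D n) ->
  exists X : nat -> A, (forall n, X n = a n + sigma (X n.+1)) /\
    (forall n, nrm (X n) <= 2 * D n).
Proof.
move=> D0 D2 aD.
(* [s m n] is [X n] cut off after m terms. *)
pose fix s (m n : nat) {struct m} : A := if m is m'.+1 then a n + sigma (s m' n.+1) else 0.
have s_bnd m n : nrm (s m n) <= 2 * D n.
  elim: m n => [|m IH] n /=; first by rewrite nrm0 mulr_ge0// ltW.
  have := ba_nrmD HA (a n) (sigma (s m n.+1)).
  by have := sigma_contr (s m n.+1); have := IH n.+1; have := aD n; have := D2 n; lra.
(* The two truncations share their first m terms; what remains is sigma^m of a truncation that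
   starts at n + m. *)
have s_diff m j n : nrm (s (m + j)%N n - s m n) <= 2 * D (n + m)%N.
  elim: m n => [|m IH] n /=; first by rewrite subr0 addn0 add0n; exact: s_bnd.
  rewrite opprD addrACA subrr add0r -sigmaB.
  by apply: le_trans (sigma_contr _) _; rewrite -addSnnS; exact: IH.
have DX n k : D (n + k)%N <= D n / 2 ^+ k.
  elim: k => [|k IH]; first by rewrite addn0 expr0 divr1.
  rewrite addnS; apply: le_trans (D2 _) _.
  by rewrite exprSr invfM mulrA ler_pM2r// invr_gt0.
have D_small n eps : 0 < eps -> exists m, forall k, (m <= k)%N -> D (n + k)%N < eps.
  move=> eps0.
  exists (Num.truncn (D n / eps)).+1 => k mk.
  apply: le_lt_trans (DX n k) _.
  have k2 : k%:R < 2 ^+ k :> R by rewrite -natrX ltr_nat ltn_expl.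
  rewrite ltr_pdivrMr ?exprn_gt0// mulrC -ltr_pdivrMr//.
  apply: lt_trans k2; apply: lt_le_trans (truncnS_gt _) _.
  by rewrite ler_nat.
have lim n : exists l, forall eps, 0 < eps -> exists M, forall m, (M <= m)%N ->
    nrm (s m n - l) < eps.
  apply: (ba_complete HA) => eps eps0.
  have [M hM] := D_small n (eps / 4) ltac:(lra).
  exists M => p q Mp Mq.
  have h k : (M <= k)%N -> nrm (s k n - s M n) < eps / 2.
    move=> Mk; rewrite -(subnKC Mk); apply: le_lt_trans (s_diff _ _ _) _.
    by have := hM M (leqnn M); lra.
  have := h _ Mp; have := h _ Mq.
  have := ba_nrmD HA (s p n - s M n) (s M n - s q n).
  by rewrite addrA subrK (nrmB (s M n)); lra.
have [X hX] := choice lim.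
exists X; split=> n.
  (* The limit of [s m.+1 n = a n + sigma (s m n.+1)], using that sigma is a contraction. *)
  apply/eqP; rewrite -subr_eq0; apply/eqP/nrm_small_eq0 => eps eps0.
  have [M1 h1] := hX n (eps / 2) ltac:(lra).
  have [M2 h2] := hX n.+1 (eps / 2) ltac:(lra).
  pose m := maxn M1 M2.
  have {}h1 := h1 m.+1 (leq_trans (leq_maxl _ _) (leqnSn _)).
  have {}h2 := h2 m (leq_maxr _ _).
  have e : X n - (a n + sigma (X n.+1)) = (X n - s m.+1 n) + sigma (s m n.+1 - X n.+1).
    rewrite sigmaB /= opprD !addrA; congr (_ + _).
    by rewrite -!addrA opprD -(addrA (- a n)) addNr addr0.
  rewrite e; apply: le_lt_trans (ba_nrmD HA _ _) _.
  have := sigma_contr (s m n.+1 - X n.+1).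
  by move: h1; rewrite nrmB; lra.
apply/ler_addgt0Pr => e e0.
have [M /(_ M (leqnn _)) h] := hX n e e0.
have := ba_nrmD HA (s M n) (X n - s M n); rewrite addrC subrK (nrmB (X n)).
by have := s_bnd M n; lra.
Qed.

(* The gliding hump: the [n]-th term of a twisted series is chosen so large
   for some [p i] that neither the earlier terms nor the tail can compensate. *)
Lemma gliding_hump (I : Type) (p : I -> A -> R) (N : A -> R) :
  (forall i a, 0 <= p i a) ->
  (forall i a b, p i (a + b) <= p i a + p i b) ->
  (forall i a, p i (- a) <= p i a) ->
  (forall i a, p i a <= N a) ->
  ~ (forall (n : nat) (D M : R), 0 < D -> exists i (C : R) (a : A),
      [/\ 0 <= C, nrm a <= D, M <= p i (iter n sigma a) &
          forall y, p i (iter n.+1 sigma y) <= C * nrm y]).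
Proof.
move=> p0 pD pN pb H.
(* [x] packs the stage n, the admissible size D and the sum S of the earlier terms. In the demanded
   value n + N S + 2, the summand N S outweighs the earlier terms, 2 the tail and n the whole
   series. *)
have H' (x : nat * (R * A)) : exists aC : A * R, 0 < x.2.1 ->
    exists i, [/\ 0 <= aC.2, nrm aC.1 <= x.2.1,
      x.1%:R + N x.2.2 + 2 <= p i (iter x.1 sigma aC.1) &
      forall y, p i (iter x.1.+1 sigma y) <= aC.2 * nrm y].
  have [D0|D0] := boolP (0 < x.2.1); last by exists (0, 0) => D1; case/negP: D0.
  have [i [C [a h]]] := H x.1 x.2.1 (x.1%:R + N x.2.2 + 2) D0.
  by exists (a, C) => _; exists i.
have [G hG] := choice H'.
(* [st n] is the pair (D n, S n). Halving D feeds [twisted_series]; the bound 1 / (C n + 1) keeps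
   all later terms small for the index chosen at stage n. *)
pose fix st (n : nat) {struct n} : R * A := if n is m.+1 then
  let x := st m in let g := G (m, x) in
  (Num.min (x.1 / 2) (g.2 + 1)^-1, x.2 + iter m sigma g.1) else (1, 0).
pose D n := (st n).1; pose S n := (st n).2; pose a n := (G (n, st n)).1.
pose C n := (G (n, st n)).2.
have D0 n : 0 < D n.
  elim: n => [|n IH]; first exact: ltr01.
  rewrite /D /= lt_min; apply/andP; split; first by rewrite divr_gt0.
  by have [i [C0 _ _ _]] := hG (n, st n) IH; rewrite invr_gt0; move: C0 => /=; lra.
have D2 n : D n.+1 <= D n / 2 by rewrite /D /= ge_min lexx.
have aD n : nrm (a n) <= D n by have [i [_ ? _ _]] := hG (n, st n) (D0 n).
have [X [XS Xb]] := twisted_series a D D0 D2 aD.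
have XE n : X 0 = S n + iter n sigma (X n).
  elim: n => [|n IH]; first by rewrite /S /= add0r.
  by rewrite IH XS iter_sigmaD addrA -iterSr.
(* A stage beyond N (X 0): the hump there is X 0 minus the earlier terms and the tail, so [p i] of
   it stays below n + N (S n) + 2, a contradiction. *)
pose n := (Num.truncn (N (X 0))).+1.
have [i [C0 _ big small]] := hG (n, st n) (D0 n).
have small1 : p i (iter n.+1 sigma (X n.+1)) <= 2.
  apply: le_trans (small _) _.
  have C1 : 0 < C n + 1 by move: C0; rewrite -/(C n) /=; lra.
  have DC : (C n + 1) * D n.+1 <= 1.
    have : D n.+1 <= (C n + 1)^-1 by rewrite /D /= ge_min lexx orbT.
    by rewrite -(ler_pM2l C1) divff ?gt_eqF.
  rewrite -/(C n) /=; apply: le_trans (ler_wpM2l C0 (Xb n.+1)) _.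
  by have := D0 n.+1; rewrite -/(C n); lra.
have e : iter n sigma (a n) = X 0 + - (S n + iter n.+1 sigma (X n.+1)).
  by rewrite (XE n) [X n]XS iter_sigmaD -iterSr addrCA addrK.
have {}big : n%:R + N (S n) + 2 <= p i (iter n sigma (a n)) := big.
rewrite e in big.
have := pD i (X 0) (- (S n + iter n.+1 sigma (X n.+1))).
have := pD i (S n) (iter n.+1 sigma (X n.+1)).
have := pb i (S n); have := pb i (X 0); have := truncnS_gt (N (X 0)).
have := pN i (S n + iter n.+1 sigma (X n.+1)).
by rewrite -/n; lra.
Qed.

End Glide.
End BanachAlgebra.

(** * Square-summable vectors on paths and bounded operators *)

Section PathSpace.
Context {R : realType} {V E : countType} {r s : E -> V}.
Local Notation rawpath := (rawpath V E).
Local Notation vec := (vec R V E).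
Local Notation op := (op R V E).
Local Notation in_l2 := (in_l2 r s).
Local Notation in_alg := (Defs.in_alg r s).
Implicit Types (x y : vec) (F : seq rawpath) (T S : op).

Definition path_supported x := forall w, ~~ is_path r s w -> x w = 0.

(** An [esum] of nonnegative terms is the supremum of its finite partial sums, so the norm estimates
    below are made on duplicate-free lists. *)
Lemma l2sq_leP x (c : R) :
  (l2sq x <= c%:E)%E <->
  (forall F, uniq F -> \sum_(w <- F) cmod (x w) ^+ 2 <= c).
Proof.
split=> [h F uF|h].
  rewrite -lee_fin; apply: le_trans h; rewrite -sumEFin.
  apply: esum_ge; exists [set` F]; first by split=> //; exact: finite_seq.
  by rewrite -fsbig_seq.
apply: ge_ereal_sup => _ [A [finA _] <-].
by rewrite fsbig_finite// sumEFin lee_fin h//; exact: finmap.fset_uniq.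
Qed.

Lemma l2sq_ge0 x : (0 <= l2sq x)%E.
Proof. by apply: esum_ge0 => w _; rewrite lee_fin exprn_ge0// cmod_ge0. Qed.

Lemma l2norm_ge0 x : 0 <= l2norm x.
Proof. exact: sqrtr_ge0. Qed.

Lemma sum_le_l2norm x F : in_l2 x -> uniq F ->
  \sum_(w <- F) cmod (x w) ^+ 2 <= l2norm x ^+ 2.
Proof.
move=> [_ fin_x] uF; rewrite sqr_sqrtr; last by rewrite fine_ge0// l2sq_ge0.
apply: (l2sq_leP _ _).1 => //; rewrite fineK// ge0_fin_numE//; exact: l2sq_ge0.
Qed.

Lemma cmod_le_l2norm x w : in_l2 x -> cmod (x w) <= l2norm x.
Proof.
move=> x2; have := sum_le_l2norm x [:: w] x2 isT.
by rewrite big_seq1 ler_sqr ?nnegrE ?cmod_ge0 ?l2norm_ge0.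
Qed.

Lemma l2norm_le x (c : R) : 0 <= c ->
  (forall F, uniq F -> \sum_(w <- F) cmod (x w) ^+ 2 <= c ^+ 2) ->
  l2norm x <= c.
Proof.
move=> c0 /(l2sq_leP _ _).2 h.
rewrite -[leRHS](ger0_norm c0) -sqrtr_sqr ler_wsqrtr//.
rewrite -lee_fin fineK// ge0_fin_numE ?l2sq_ge0//.
exact: le_lt_trans h (ltry _).
Qed.

Lemma sum_single_le u x F : (forall w, w != u -> x w = 0) -> uniq F ->
  \sum_(w <- F) cmod (x w) ^+ 2 <= cmod (x u) ^+ 2.
Proof.
move=> xu uF; have z w : w != u -> cmod (x w) ^+ 2 = 0.
  by move=> /xu ->; rewrite cmod0 expr0n.
have [uin|unin] := boolP (u \in F).
  by rewrite (bigD1_seq u)//= big1// addr0.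
rewrite big1_seq ?sqr_ge0// => w /andP[_ wF]; apply: z.
by apply: contraNneq unin => <-.
Qed.

Lemma in_l2_le x (c : R) : path_supported x ->
  (forall F, uniq F -> \sum_(w <- F) cmod (x w) ^+ 2 <= c) -> in_l2 x.
Proof.
by move=> sx /(l2sq_leP _ _).2 h; split=> //; exact: le_lt_trans h (ltry _).
Qed.

(** Injectivity of [h] on the support of [y] turns a partial sum of [y] into one of [x] without
    repetitions. This covers [Lop], restrictions and the deletion of initial segments. *)
Lemma l2_reindex (h : rawpath -> rawpath) x y :
  in_l2 x -> path_supported y ->
  (forall w, y w != 0 -> cmod (y w) <= cmod (x (h w))) ->
  (forall w w', y w != 0 -> y w' != 0 -> h w = h w' -> w = w') ->
  in_l2 y /\ l2norm y <= l2norm x.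
Proof.
move=> x2 sy le_yx inj_h.
have hF F : uniq F -> \sum_(w <- F) cmod (y w) ^+ 2 <= l2norm x ^+ 2.
  move=> uF; rewrite (bigID (fun w => y w != 0)) /= addrC big1 ?add0r; last first.
    by move=> w; rewrite negbK => /eqP ->; rewrite cmod0 expr0n.
  rewrite -big_filter.
  apply: (@le_trans _ _ (\sum_(w <- map h [seq w <- F | y w != 0]) cmod (x w) ^+ 2)).
    rewrite big_map big_filter [leRHS]big_filter; apply: ler_sum => w yw.
    by rewrite ler_sqr ?nnegrE ?cmod_ge0// le_yx.
  apply: sum_le_l2norm => //; rewrite map_inj_in_uniq ?filter_uniq//.
  by move=> w w'; rewrite !mem_filter => /andP[yw _] /andP[yw' _]; exact: inj_h.
split; first exact: in_l2_le hF.
by apply: l2norm_le hF; exact: l2norm_ge0.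
Qed.

Lemma l2_add x y : in_l2 x -> in_l2 y ->
  in_l2 (fun w => x w + y w) /\ l2norm (fun w => x w + y w) <= l2norm x + l2norm y.
Proof.
move=> x2 y2.
(* Minkowski's inequality from a weighted Cauchy-Schwarz: the pointwise bound has defect (b p - a
   q)^2 / (a b). Taking a and b strictly above the norms makes them positive. *)
have key (a b : R) F : l2norm x < a -> l2norm y < b -> uniq F ->
    \sum_(w <- F) cmod (x w + y w) ^+ 2 <= (a + b) ^+ 2.
  move=> xa yb uF.
  have a0 := le_lt_trans (l2norm_ge0 x) xa; have b0 := le_lt_trans (l2norm_ge0 y) yb.
  have pw w : cmod (x w + y w) ^+ 2 <=
      (a + b) / a * cmod (x w) ^+ 2 + (a + b) / b * cmod (y w) ^+ 2.
    set p := cmod (x w); set q := cmod (y w).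
    apply: (@le_trans _ _ ((p + q) ^+ 2)).
      by rewrite ler_sqr ?nnegrE ?addr_ge0 ?cmod_ge0// cmodD.
    rewrite -subr_ge0.
    have -> : (a + b) / a * p ^+ 2 + (a + b) / b * q ^+ 2 - (p + q) ^+ 2 =
        (b * p - a * q) ^+ 2 / (a * b).
      by field; rewrite !gt_eqF.
    by rewrite divr_ge0 ?sqr_ge0// mulr_ge0// ltW.
  apply: le_trans (ler_sum _ (fun w _ => pw w)) _.
  rewrite big_split /= -!mulr_sumr.
  have sq (z : vec) c : in_l2 z -> l2norm z < c ->
      \sum_(w <- F) cmod (z w) ^+ 2 <= c ^+ 2.
    move=> z2 zc; apply: le_trans (sum_le_l2norm z F z2 uF) _.
    by rewrite ler_sqr ?nnegrE ?l2norm_ge0 ?ltW// (le_lt_trans (l2norm_ge0 z)).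
  have ab0 : 0 < a + b by rewrite addr_gt0.
  have h1 : (a + b) / a * \sum_(w <- F) cmod (x w) ^+ 2 <= (a + b) / a * a ^+ 2.
    by rewrite ler_pM2l ?divr_gt0// sq.
  have h2 : (a + b) / b * \sum_(w <- F) cmod (y w) ^+ 2 <= (a + b) / b * b ^+ 2.
    by rewrite ler_pM2l ?divr_gt0// sq.
  apply: le_trans (lerD h1 h2) _.
  by rewrite le_eqVlt; apply/orP; left; apply/eqP; field; rewrite !gt_eqF.
split.
  apply: (@in_l2_le _ ((l2norm x + 1 + (l2norm y + 1)) ^+ 2)).
    by move=> w nw; rewrite x2.1// y2.1// addr0.
  by move=> F uF; apply: key => //; rewrite ltrDl.
apply/ler_addgt0Pr => e e0.
apply: l2norm_le => [|F uF]; first by rewrite !addr_ge0 ?l2norm_ge0// ltW.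
have -> : l2norm x + l2norm y + e = (l2norm x + e / 2) + (l2norm y + e / 2) by field.
by apply: key => //; rewrite ltrDl divr_gt0.
Qed.

Lemma l2_scale (k : R[i]) x : in_l2 x ->
  in_l2 (fun w => k * x w) /\ l2norm (fun w => k * x w) <= cmod k * l2norm x.
Proof.
move=> x2.
have hF F : uniq F ->
    \sum_(w <- F) cmod (k * x w) ^+ 2 <= (cmod k * l2norm x) ^+ 2.
  move=> uF; under eq_bigr do rewrite cmodM exprMn.
  by rewrite -mulr_sumr exprMn ler_wpM2l ?sqr_ge0// sum_le_l2norm.
split; first by apply: in_l2_le hF => w nw; rewrite x2.1// mulr0.
by apply: l2norm_le hF; rewrite mulr_ge0 ?cmod_ge0 ?l2norm_ge0.
Qed.

Lemma l2_zero : in_l2 ((fun _ => 0) : vec) /\ l2norm ((fun _ => 0) : vec) <= 0.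
Proof.
have h F : uniq F -> \sum_(w <- F) cmod (0 : R[i]) ^+ 2 <= (0 : R) ^+ 2.
  by move=> _; rewrite big1 ?sqr_ge0// => w _; rewrite cmod0 expr0n.
by split; [exact: in_l2_le h | exact: l2norm_le h].
Qed.

Lemma l2_Lop e x : in_l2 x -> in_l2 (Lop r s e x) /\ l2norm (Lop r s e x) <= l2norm x.
Proof.
move=> x2; apply: (l2_reindex (fun w => (s e, behead w.2))) => //.
- move=> [v [|f es]]//=; rewrite /is_path /Lop /= => nw.
  case: ifP => // /andP[/eqP ef /eqP ve]; move: nw; rewrite ef ve eqxx /= => nw.
  exact: x2.1.
- by move=> [v [|f es]] /=; rewrite /Lop /= ?eqxx//; case: ifP => //; rewrite eqxx.
- move=> [v [|f es]] [v' [|f' es']]; rewrite /Lop /= ?eqxx//.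
  case: ifP => [/andP[/eqP -> /eqP ->] _|]; last by rewrite eqxx.
  case: ifP => [/andP[/eqP -> /eqP ->] _|]; last by rewrite eqxx.
  by case=> ->.
Qed.

Definition restr (Q : pred rawpath) x : vec := fun w => if Q w then x w else 0.

Lemma l2_restr Q x : in_l2 x -> in_l2 (restr Q x) /\ l2norm (restr Q x) <= l2norm x.
Proof.
move=> x2; apply: (l2_reindex id) => //.
- by move=> w nw; rewrite /restr; case: ifP => // _; exact: x2.1.
- by move=> w; rewrite /restr; case: ifP => // _; rewrite eqxx.
Qed.

Definition basis_vec (u : rawpath) : vec := fun w => (w == u)%:R.

Lemma l2_basis_vec u : is_path r s u ->
  in_l2 (basis_vec u) /\ l2norm (basis_vec u) <= 1.
Proof.
move=> pu.
have hF F : uniq F -> \sum_(w <- F) cmod (basis_vec u w) ^+ 2 <= 1 ^+ 2.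
  move=> uF; have := sum_single_le u (basis_vec u) F _ uF.
  rewrite /basis_vec eqxx cmod1; apply=> w; by case: eqP.
split; last exact: l2norm_le hF.
by apply: in_l2_le hF => w nw; rewrite /basis_vec; case: eqP => // e; rewrite e pu in nw.
Qed.

Lemma bounded_op_comp T S : bounded_op r s T -> bounded_op r s S ->
  bounded_op r s (fun x => T (S x)).
Proof.
move=> [T2 [Tl [M TM]]] [S2 [Sl [M' SM]]]; split=> [x /S2 /T2//|]; split.
  by move=> c x y x2 y2; rewrite Sl// Tl//; exact: S2.
exists (`|M| * `|M'|) => x x2; apply: le_trans (TM _ (S2 x x2)) _.
apply: (@le_trans _ _ (`|M| * l2norm (S x))).
  by rewrite ler_wpM2r ?l2norm_ge0// ler_norm.
rewrite -mulrA ler_wpM2l//; apply: le_trans (SM x x2) _.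
by rewrite ler_wpM2r ?l2norm_ge0// ler_norm.
Qed.

Lemma bounded_op_add T S : bounded_op r s T -> bounded_op r s S ->
  bounded_op r s (fun x w => T x w + S x w).
Proof.
move=> [T2 [Tl [M TM]]] [S2 [Sl [M' SM]]].
split=> [x x2|]; first exact: (l2_add _ _ (T2 x x2) (S2 x x2)).1.
split=> [c x y x2 y2|].
  by apply/funext => w; rewrite Sl// Tl// mulrDr addrACA.
exists (M + M') => x x2; apply: le_trans (l2_add _ _ (T2 x x2) (S2 x x2)).2 _.
by rewrite mulrDl; apply: lerD; [exact: TM | exact: SM].
Qed.

Lemma bounded_op_scale (k : R[i]) T : bounded_op r s T ->
  bounded_op r s (fun x w => k * T x w).
Proof.
move=> [T2 [Tl [M TM]]].
split=> [x x2|]; first exact: (l2_scale _ _ (T2 x x2)).1.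
split=> [c x y x2 y2|].
  by apply/funext => w; rewrite Tl// mulrDr !mulrA [k * c]mulrC.
exists (cmod k * M) => x x2; apply: le_trans (l2_scale _ _ (T2 x x2)).2 _.
by rewrite -mulrA ler_wpM2l ?cmod_ge0// TM.
Qed.

Lemma bounded_opsub T S : bounded_op r s T -> bounded_op r s S ->
  bounded_op r s (opsub T S).
Proof.
move=> hT hS.
have -> : opsub T S = (fun x w => T x w + -1 * S x w).
  by apply/funext => x; apply/funext => w; rewrite mulN1r.
exact/bounded_op_add/bounded_op_scale.
Qed.

Lemma in_alg_bounded T : in_alg T -> bounded_op r s T.
Proof.
elim=> {T} [|e|v|T S _ hT _ hS|c T _ hT|T S _ hT _ hS].
- split=> [x _|]; first exact: l2_zero.1.
  split=> [c x y _ _|]; first by apply/funext => w; rewrite mulr0 addr0.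
  by exists 0 => x _; rewrite mul0r; exact: l2_zero.2.
- split=> [x x2|]; first exact: (l2_Lop _ _ x2).1.
  split=> [c x y _ _|]; last by exists 1 => x x2; rewrite mul1r (l2_Lop _ _ x2).2.
  apply/funext => -[v [|f es]]; rewrite /Lop /= ?mulr0 ?addr0//.
  by case: ifP => // _; rewrite mulr0 addr0.
- have e x : Pop v x = restr (fun w => w.1 == v) x by [].
  split=> [x x2|]; first by rewrite e; exact: (l2_restr _ _ x2).1.
  split=> [c x y _ _|].
    by apply/funext => w; rewrite /Pop; case: ifP => // _; rewrite mulr0 addr0.
  by exists 1 => x x2; rewrite mul1r e (l2_restr _ _ x2).2.
- exact: bounded_op_add.
- exact: bounded_op_scale.
- exact: bounded_op_comp.
Qed.

Lemma bounded_op0 T : bounded_op r s T -> T (fun _ => 0) = (fun _ => 0).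
Proof.
move=> [_ [Tl _]].
have := Tl (-1) (fun _ => 0) (fun _ => 0) l2_zero.1 l2_zero.1.
have -> : (fun w : rawpath => -1 * 0 + 0 : R[i]) = (fun _ => 0).
  by apply/funext => w; rewrite mulr0 addr0.
by move=> ->; apply/funext => w; rewrite mulN1r addNr.
Qed.

Lemma bounded_opZ T (k : R[i]) x : bounded_op r s T -> in_l2 x ->
  T (fun w => k * x w) = (fun w => k * T x w).
Proof.
move=> hT x2.
have -> : (fun w => k * x w) = (fun w => k * x w + 0).
  by apply/funext => w; rewrite addr0.
rewrite hT.2.1//; last exact: l2_zero.1.
by apply/funext => w; rewrite bounded_op0// addr0.
Qed.

Lemma opnorm_le T (c : R) :
  (forall x, in_l2 x -> l2norm x <= 1 -> l2norm (T x) <= c) -> opnorm r s T <= c.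
Proof.
move=> h; apply: ge_sup; last by move=> _ [x [x2 x1] <-]; exact: h.
exists (l2norm (T (fun _ => 0))), (fun _ => 0) => //; split; first exact: l2_zero.1.
exact: le_trans l2_zero.2 ler01.
Qed.

Lemma le_opnorm T x : bounded_op r s T -> in_l2 x -> l2norm x <= 1 ->
  l2norm (T x) <= opnorm r s T.
Proof.
move=> [_ [_ [M TM]]] x2 x1; apply: ub_le_sup; last by exists x.
exists `|M| => _ [y [y2 y1] <-]; apply: le_trans (TM y y2) _.
apply: le_trans (ler_wpM2r (l2norm_ge0 y) (ler_norm M)) _.
by rewrite ler_piMr.
Qed.

(** Scaling by 1/c with any positive c above the norm of [x] avoids a separate case x = 0. *)
Lemma le_opnormM T x (c : R) : bounded_op r s T -> in_l2 x -> 0 < c ->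
  l2norm x <= c -> l2norm (T x) <= c * opnorm r s T.
Proof.
move=> hT x2 c0 xc.
pose y : vec := fun w => (c^-1)%:C%C * x w.
have [y2 yn] := l2_scale (c^-1)%:C%C x x2.
have y1 : l2norm y <= 1.
  apply: le_trans yn _; rewrite cmod_real gtr0_norm ?invr_gt0//.
  by rewrite ler_pdivrMl// mulr1.
have -> : x = (fun w => c%:C%C * y w).
  apply/funext => w; rewrite /y mulrA -rmorphM /= divff ?gt_eqF//.
  by rewrite mul1r.
rewrite bounded_opZ//; apply: le_trans (l2_scale _ _ (hT.1 y y2)).2 _.
by rewrite cmod_real gtr0_norm// ler_pM2l// le_opnorm.
Qed.

(** A coefficient is bounded by the l2 norm, so norm approximation is uniform in w. One [S] serves
    two vectors because [Tplus_strip] compares [T] on [strip us x] and on [x]. *)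
Lemma Tplus_approx T x y (eps : R) : in_Tplus r s T -> in_l2 x -> in_l2 y ->
  0 < eps -> exists2 S, in_alg S &
    forall w, cmod (T x w - S x w) < eps /\ cmod (T y w - S y w) < eps.
Proof.
move=> [hT apT] x2 y2 eps0.
pose c := l2norm x + l2norm y + 1.
have c0 : 0 < c by rewrite /c ltr_wpDl// addr_ge0// l2norm_ge0.
have [S [aS nS]] := apT (eps / c) (divr_gt0 eps0 c0).
have hD := bounded_opsub T S hT (in_alg_bounded S aS).
exists S => // w.
have h (z : vec) : in_l2 z -> l2norm z <= c -> cmod (T z w - S z w) < eps.
  move=> z2 zc; have := cmod_le_l2norm _ w (hD.1 z z2).
  move=> /le_lt_trans; apply; apply: le_lt_trans (le_opnormM _ _ c hD z2 c0 zc) _.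
  by rewrite mulrC -ltr_pdivlMr.
by have := l2norm_ge0 x; have := l2norm_ge0 y; split; apply: h => //; rewrite /c; lra.
Qed.

End PathSpace.

(** * Invariant subspaces of T_+(G), deletion of initial segments, weighted shifts *)

Section Structure.
Context {R : realType} {V E : countType} {r s : E -> V}.
Local Notation rawpath := (rawpath V E).
Local Notation vec := (vec R V E).
Local Notation op := (op R V E).
Local Notation in_l2 := (in_l2 r s).
Local Notation in_alg := (Defs.in_alg r s).
Implicit Types (x y : vec) (T S : op) (w : rawpath) (us : seq E).

Lemma small_eq0 (z : R[i]) : (forall eps : R, 0 < eps -> cmod z < eps) -> z = 0.
Proof.
move=> h; apply: cmod_eq0; apply/eqP; rewrite eq_le cmod_ge0 andbT.
by apply/ler_addgt0Pr => e e0; rewrite add0r ltW// h.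
Qed.

(** A left ideal of paths. [Lop] only adds edges at the range end, so the vectors supported on such
    a set form an invariant subspace for T_+(G). *)
Definition prepend_closed (Q : rawpath -> Prop) :=
  forall e es, Q (s e, es) -> Q (r e, e :: es).

Lemma in_alg_supp (Q : rawpath -> Prop) T x : prepend_closed Q -> in_alg T ->
  (forall w, ~ Q w -> x w = 0) -> forall w, ~ Q w -> T x w = 0.
Proof.
move=> Qc aT; elim: aT x => {T} [|e|v|T S _ hT _ hS|c T _ hT|T S _ hT _ hS] x xQ w nQ //.
- case: w nQ => [v [|f es]] nQ; rewrite /Lop //=.
  case: ifP => // /andP[/eqP fe /eqP ve]; apply: xQ => /Qc q; apply: nQ.
  by rewrite ve fe.
- by rewrite /Pop; case: ifP => // _; exact: xQ.
- by rewrite hT// hS// addr0.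
- by rewrite hT// mulr0.
- by apply: hT => // w' nQ'; exact: hS.
Qed.

Lemma Tplus_supp (Q : rawpath -> Prop) T x : prepend_closed Q ->
  in_Tplus r s T -> in_l2 x ->
  (forall w, ~ Q w -> x w = 0) -> forall w, ~ Q w -> T x w = 0.
Proof.
move=> Qc hT x2 xQ w nQ; apply: small_eq0 => eps eps0.
have [S aS /(_ w) [h _]] := Tplus_approx T x x eps hT x2 x2 eps0.
by rewrite (in_alg_supp Q S x)// subr0 in h.
Qed.

(** Edges are listed from range to source, so [us] is the initial segment of the path. On
    path-supported vectors this is the adjoint of right multiplication by [us]. *)
Definition strip us x : vec := fun w => x (w.1, w.2 ++ us).

Lemma valid_edges_cat v (es us : seq E) :
  valid_edges r s v (es ++ us) =
  valid_edges r s v es && valid_edges r s (last v (map s es)) us.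
Proof. by elim: es v => //= e es IH v; rewrite IH andbA. Qed.

Lemma l2_strip us x : in_l2 x ->
  in_l2 (strip us x) /\ l2norm (strip us x) <= l2norm x.
Proof.
move=> x2; apply: (l2_reindex (fun w => (w.1, w.2 ++ us))) => //.
- move=> [v es] /= nw; apply: x2.1; apply: contra nw.
  by rewrite /is_path /= valid_edges_cat => /andP[].
- move=> [v es] [v' es'] _ _ /= [-> e]; congr (_, _).
  have sz : size es = size es' by have := congr1 size e; rewrite !size_cat => /addIn.
  by move/eqP: e; rewrite eqseq_cat// => /andP[/eqP].
Qed.

(* If [x] did not vanish on shorter paths, [L_e] could create the very edges
   that [strip us] removes. *)
Lemma in_alg_strip T us x : in_alg T ->
  (forall w, (size w.2 < size us)%N -> x w = 0) ->
  T (strip us x) = strip us (T x).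
Proof.
move=> aT; elim: aT x => {T} [|e|v|T S _ hT _ hS|c T _ hT|T S _ hT aS hS] x xs //.
- apply/funext => -[v [|f es]] //; rewrite /strip /Lop /=.
  case: us xs => //= f us xs; case: ifP => // _; rewrite xs//.
- by apply/funext => w; rewrite hT// hS.
- by apply/funext => w; rewrite hT.
- rewrite hS// hT// => w wus.
  apply: (in_alg_supp (fun w => ~~ (size w.2 < size us)%N) S x) => //.
  + by move=> e es /=; rewrite -!leqNgt => /leq_trans; apply.
  + by move=> w' /negP; rewrite negbK; exact: xs.
  + by rewrite wus.
Qed.

Lemma Tplus_strip T us x : in_Tplus r s T -> in_l2 x ->
  (forall w, (size w.2 < size us)%N -> x w = 0) ->
  forall w, T (strip us x) w = T x (w.1, w.2 ++ us).
Proof.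
move=> hT x2 xs w; apply/eqP; rewrite -subr_eq0; apply/eqP/small_eq0 => eps eps0.
have [S aS ap] := Tplus_approx T (strip us x) x (eps / 2) hT
  (l2_strip us x x2).1 x2 ltac:(lra).
have [h1 _] := ap w; have [_ h2] := ap (w.1, w.2 ++ us).
have -> : T (strip us x) w - T x (w.1, w.2 ++ us) =
    (T (strip us x) w - S (strip us x) w) + (S x (w.1, w.2 ++ us) - T x (w.1, w.2 ++ us)).
  by rewrite (in_alg_strip S)// addrA subrK.
apply: le_lt_trans (cmodD _ _) _; move: h1 h2.
by rewrite (cmodB (T x _)); lra.
Qed.

(** The operator sum_e om_e L_e: at a nonempty path only the summand of its leading edge can be
    nonzero, so no infinite sum appears. *)
Definition wshift (om : E -> R[i]) : op := fun x w =>
  if w.2 is e :: es then if w.1 == r e then om e * x (s e, es) else 0 else 0.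

Lemma iter_wshift_short om N x w : (size w.2 < N)%N -> iter N (wshift om) x w = 0.
Proof.
elim: N w => // N IH [v [|e es]]//=; rewrite ltnS => h; rewrite /wshift /=.
by case: ifP => // _; rewrite IH// mulr0.
Qed.

Lemma iter_wshift_cat om x v (ps es : seq E) :
  iter (size ps) (wshift om) x (v, ps ++ es) =
  (valid_edges r s v ps)%:R * \prod_(e <- ps) om e * x (last v (map s ps), es).
Proof.
elim: ps v => [|e ps IH] v /=; first by rewrite big_nil !mul1r.
rewrite {1}/wshift /= eq_sym; case: eqP => _; last by rewrite !mul0r.
by rewrite IH big_cons; ring.
Qed.

(** The vectors L_e x have disjoint supports, so the squared norm of W x is the sum of |om_e|^2 |L_e
    x|^2, and each L_e is a contraction. *)
Lemma l2_wshift om (c : R) x : 0 <= c ->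
  (forall es : seq E, uniq es -> \sum_(e <- es) cmod (om e) ^+ 2 <= c ^+ 2) ->
  in_l2 x -> in_l2 (wshift om x) /\ l2norm (wshift om x) <= c * l2norm x.
Proof.
move=> c0 omc x2.
have hF (F : seq rawpath) : uniq F ->
    \sum_(w <- F) cmod (wshift om x w) ^+ 2 <= (c * l2norm x) ^+ 2.
  move=> uF.
  pose es := undup (flatten (map snd F)).
  have pw w : w \in F -> cmod (wshift om x w) ^+ 2 <=
      \sum_(e <- es) cmod (om e) ^+ 2 * cmod (Lop r s e x w) ^+ 2.
    case: w => [v [|f us]] wF.
      by rewrite /wshift cmod0 expr0n sumr_ge0// => e _; rewrite mulr_ge0 ?sqr_ge0.
    have fes : f \in es.
      rewrite mem_undup; apply/flattenP; exists (f :: us); last exact: mem_head.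
      by apply/mapP; exists (v, f :: us).
    rewrite (bigD1_seq f)//= ?undup_uniq// -[leLHS]addr0 lerD//.
      rewrite /wshift /Lop /= eqxx /=; case: ifP => _; rewrite ?cmodM ?exprMn//.
      by rewrite cmod0 expr0n mulr0.
    by rewrite sumr_ge0// => e _; rewrite mulr_ge0 ?sqr_ge0.
  rewrite big_seq; apply: le_trans (ler_sum _ pw) _.
  rewrite -big_seq exchange_big /=.
  apply: (@le_trans _ _ (\sum_(e <- es) cmod (om e) ^+ 2 * l2norm x ^+ 2)).
    apply: ler_sum => e _; rewrite -mulr_sumr ler_wpM2l ?sqr_ge0//.
    have [Lx Lb] := l2_Lop e x x2.
    apply: le_trans (sum_le_l2norm _ _ Lx uF) _.
    by rewrite ler_sqr ?nnegrE ?l2norm_ge0.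
  by rewrite -mulr_suml exprMn ler_wpM2r ?sqr_ge0// omc// undup_uniq.
have cx0 : 0 <= c * l2norm x by rewrite mulr_ge0 ?l2norm_ge0.
split; last exact: l2norm_le hF.
apply: in_l2_le hF => -[v [|e es]]//; rewrite /is_path /wshift /=.
by rewrite eq_sym; case: ifP => //= _ nw; rewrite x2.1// mulr0.
Qed.

(** Since [pickle] is injective, these positive weights are summable however many edges there
    are. *)
Definition weight (e : E) : R := 2^-1 ^+ pickle e.

Lemma weight_gt0 e : 0 < weight e.
Proof. by rewrite exprn_gt0// invr_gt0. Qed.

Lemma sum_weight_le (es : seq E) : uniq es -> \sum_(e <- es) weight e <= 2.
Proof.
move=> ues.
have geo n : \sum_(0 <= k < n) (2^-1 : R) ^+ k = 2 - 2 * 2^-1 ^+ n.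
  elim: n => [|n IH]; first by rewrite big_nil expr0; field.
  by rewrite big_nat_recr//= IH exprS; field.
pose ks := map pickle es.
have uks : uniq ks by rewrite map_inj_uniq//; exact: (pcan_inj pickleK).
have -> : \sum_(e <- es) weight e = \sum_(k <- ks) 2^-1 ^+ k by rewrite big_map.
pose n := (\max_(k <- ks) k).+1.
have p : perm_eq ks [seq k <- index_iota 0 n | k \in ks].
  apply: uniq_perm => //; first by rewrite filter_uniq// iota_uniq.
  move=> k; rewrite mem_filter; apply/idP/idP => [kin|/andP[]//].
  by rewrite kin mem_index_iota /= ltnS leq_bigmax_seq.
rewrite (perm_big _ p) big_filter /=.
apply: (@le_trans _ _ (\sum_(0 <= k < n) 2^-1 ^+ k)).
  by rewrite [leRHS](bigID (mem ks)) /= lerDl sumr_ge0//.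
by rewrite geo lerBlDr lerDl mulr_ge0// exprn_ge0// invr_ge0.
Qed.

(** Beyond the cutoff one of the two factors [weight e] is at most 2^-n, and the other one is
    summable. *)
Let sq_weight_sum n (es : seq E) : uniq es ->
  \sum_(e <- es) cmod (if (pickle e < n)%N then 0 else (weight e)%:C%C : R[i]) ^+ 2
   <= 2 * 2^-1 ^+ n.
Proof.
move=> ues; apply: (@le_trans _ _ (\sum_(e <- es) weight e * 2^-1 ^+ n)); last first.
  by rewrite -mulr_suml ler_wpM2r ?sum_weight_le// exprn_ge0// invr_ge0.
apply: ler_sum => e _; case: ltnP => [_|ne].
  by rewrite cmod0 expr0n mulr_ge0 ?ltW ?weight_gt0// exprn_ge0// invr_ge0.
rewrite cmod_real gtr0_norm ?weight_gt0// expr2 ler_pM2l ?weight_gt0//.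
rewrite /weight ler_wiXn2l ?invr_ge0//; lra.
Qed.

Let head n : E -> R[i] := fun e => if (pickle e < n)%N then (weight e)%:C%C else 0.
Let tail n : E -> R[i] := fun e => if (pickle e < n)%N then 0 else (weight e)%:C%C.

Let head_in_alg n : in_alg (wshift (head n)).
Proof.
elim: n => [|n IH].
  have -> : wshift (head 0) = (fun _ _ => 0) by
    apply/funext => x; apply/funext => -[v [|e es]]//;
    by rewrite /wshift /head /= mul0r if_same.
  exact: alg_zero.
(* Either the code n belongs to one edge e, whose term is added, or it codes no edge and the
   truncation does not change. *)
case en : (@pickle_inv E n) => [e|].
  have -> : wshift (head n.+1) =
      (fun x w => wshift (head n) x w + (weight e)%:C%C * Lop r s e x w).
    apply/funext => x; apply/funext => -[v [|f es]]; first by rewrite /= mulr0 addr0.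
    rewrite /wshift /Lop /head /=; case: (v =P r f) => [->|nvf].
      have pe : pickle e = n by have := @pickle_invK E n; rewrite en.
      rewrite ltnS leq_eqVlt; case: (f =P e) => [->|nfe] /=.
        by rewrite pe eqxx ltnn mul0r add0r eqxx.
      have /negbTE -> /= : pickle f != n.
        by apply/eqP => pf; apply: nfe; apply: (pcan_inj pickleK); rewrite pe.
      by rewrite mulr0 addr0.
    case: (f =P e) => [fe|_] /=; last by rewrite mulr0 addr0.
    by case: eqP => [h|_]; [case: nvf; rewrite h fe | rewrite mulr0 addr0].
  by apply: alg_add IH _; apply: alg_scale; exact: alg_L.
suff -> : wshift (head n.+1) = wshift (head n) by [].
apply/funext => x; apply/funext => -[v [|f es]]//; rewrite /wshift /head /=.
case: ifP => // _; rewrite ltnS leq_eqVlt; case: (pickle f =P n) => //= pf.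
by have := @pickleK_inv E f; rewrite pf en.
Qed.

Lemma wshift_bounded om (c : R) : 0 <= c ->
  (forall es : seq E, uniq es -> \sum_(e <- es) cmod (om e) ^+ 2 <= c ^+ 2) ->
  bounded_op r s (wshift om).
Proof.
move=> c0 hc; split=> [x x2|]; first exact: (l2_wshift om c x c0 hc x2).1.
split=> [k x y _ _|]; last by exists c => x x2; exact: (l2_wshift om c x c0 hc x2).2.
apply/funext => -[v [|e es]]; rewrite /wshift /= ?mulr0 ?addr0//.
by case: ifP => _; rewrite ?mulr0 ?addr0// mulrDr mulrCA.
Qed.

(** Cutting off at the edges with code below n leaves an element of the algebra, and the remainder
    tends to 0 in norm by [sq_weight_sum]. *)
Lemma wshift_weight_Tplus : in_Tplus r s (wshift (fun e => (weight e)%:C%C)).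
Proof.
split.
  apply: (@wshift_bounded _ 2) => // es ues.
  by apply: le_trans (sq_weight_sum 0 es ues) _; rewrite expr0; lra.
move=> eps eps0.
(* With 8 / eps^2 < 2^n the squared weights of the remainder sum to at most (eps / 2)^2. *)
pose n := (Num.truncn (8 / eps ^+ 2)).+1.
have hn : 2 * 2^-1 ^+ n <= (eps / 2) ^+ 2.
  have n2 : 8 / eps ^+ 2 < 2 ^+ n.
    apply: lt_le_trans (truncnS_gt _) _.
    by rewrite -/n -natrX ler_nat ltnW// ltn_expl.
  rewrite exprVn ler_pdivrMr ?exprn_gt0//.
  move: n2; rewrite ltr_pdivrMr ?exprn_gt0//.
  have -> : (eps / 2) ^+ 2 * 2 ^+ n = (2 ^+ n * eps ^+ 2) / 4 by field.
  by lra.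
exists (wshift (head n)); split; first exact: head_in_alg.
apply: (@le_lt_trans _ _ (eps / 2)); last by lra.
apply: opnorm_le => x x2 x1.
have -> : opsub (wshift (fun e => (weight e)%:C%C)) (wshift (head n)) x = wshift (tail n) x.
  apply/funext => -[v [|e es]]; rewrite /opsub /wshift /= ?subrr// /head /tail.
  case: ifP => _; last by rewrite subrr.
  by case: ifP => _; rewrite !mul0r ?subrr ?subr0.
have h : 0 <= eps / 2 by lra.
have [] := l2_wshift (tail n) (eps / 2) x h _ x2.
  by move=> es ues; apply: le_trans (sq_weight_sum n es ues) hn.
by move=> _ /le_trans; apply; rewrite ler_piMr.
Qed.

End Structure.

(** * Bounded coefficients and uniform boundedness *)

Section AutomaticContinuity.
Context {R : realType} {V E : countType} {r s : E -> V}.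
Context {A : lmodType R[i]} {mul : A -> A -> A} {nrm : A -> R}.
Context {phi : A -> op R V E}.
Hypothesis HA : banach_algebra mul nrm.
Hypothesis Hhom : alg_hom_op r s mul phi.
Hypothesis Hsurj : onto_Tplus r s phi.
Local Notation rawpath := (rawpath V E).
Local Notation vec := (vec R V E).
Local Notation in_l2 := (in_l2 r s).
Local Notation W := (@wshift R V E r s).
Implicit Types (a b : A) (x y : vec) (w u : rawpath).

Lemma phi_bounded a : bounded_op r s (phi a).
Proof. exact: (Hsurj.1 a).1. Qed.

Lemma phi_l2 a x : in_l2 x -> in_l2 (phi a x).
Proof. exact: (phi_bounded a).1. Qed.

Lemma phiD a b x : in_l2 x -> phi (a + b) x = (fun w => phi a x w + phi b x w).
Proof. by move=> x2; have [] := Hhom a b 0 x x2. Qed.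

Lemma phiZ (k : R[i]) a x : in_l2 x -> phi (k *: a) x = (fun w => k * phi a x w).
Proof. by move=> x2; have [_ []] := Hhom a a k x x2. Qed.

Lemma phiN a x : in_l2 x -> phi (- a) x = (fun w => - phi a x w).
Proof. by move=> x2; rewrite -scaleN1r phiZ//; apply/funext => w; rewrite mulN1r. Qed.

Lemma phiM a b x : in_l2 x -> phi (mul a b) x = phi a (phi b x).
Proof. by move=> x2; have [_ []] := Hhom a b 0 x x2. Qed.

(** A lift b0 of the weighted shift, divided by |b0| + 1. Norm at most 1 makes multiplication by [b]
    the contraction that [gliding_hump] needs, and the weights stay nonzero. *)
Lemma contractive_shift : exists b (om : E -> R[i]),
  [/\ forall e, om e != 0, nrm b <= 1 & forall x, in_l2 x -> phi b x = W om x].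
Proof.
have [b0 hb0] := Hsurj.2 _ (@wshift_weight_Tplus R V E r s).
have n0 := nrm_ge0 HA b0.
pose t := (nrm b0 + 1)^-1.
have t0 : 0 < t by rewrite invr_gt0; lra.
exists (t%:C%C *: b0), (fun e => t%:C%C * (weight e)%:C%C); split.
- move=> e; rewrite -rmorphM; apply/eqP => /(@complexI R)/eqP.
  by rewrite mulf_eq0 !gt_eqF// weight_gt0.
- rewrite (ba_nrmZ HA) cmod_real gtr0_norm// mulrC ler_pdivrMr ?mul1r; lra.
- move=> x x2; rewrite phiZ// hb0//; apply/funext => -[v [|e es]].
    by rewrite /wshift /= mulr0.
  by rewrite /wshift /=; case: ifP; rewrite ?mulr0 ?mulrA.
Qed.

(** If p stayed below M on the ball of radius D, rescaling to norm D would bound it by |M| / D times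
    the norm. The family has one member for a single coefficient and many for uniform
    boundedness. *)
Lemma unbounded_large (I : Type) (p : I -> A -> R) :
  (forall i a, 0 <= p i a) ->
  (forall i (k : R[i]) a, p i (k *: a) <= cmod k * p i a) ->
  ~ (exists C, forall i a, p i a <= C * nrm a) ->
  forall D M, 0 < D -> exists i a, nrm a <= D /\ M <= p i a.
Proof.
move=> p0 pZ unb D M D0; apply: contrapT => /forallNP small; apply: unb.
exists (`|M| / D) => i a.
have [na0|na0] := eqVneq (nrm a) 0.
  rewrite (ba_nrm_eq0 HA na0) (nrm0 HA) mulr0 -(scale0r (0 : A)).
  by apply: le_trans (pZ _ _ _) _; rewrite cmod0 mul0r.
have {}na0 : 0 < nrm a by rewrite lt_neqAle eq_sym na0 (nrm_ge0 HA).
pose k := D / nrm a; have k0 : 0 < k by rewrite divr_gt0.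
have : p i (k%:C%C *: a) < M.
  rewrite ltNge; apply/negP => Mp; apply: (small i); exists (k%:C%C *: a); split=> //.
  by rewrite (ba_nrmZ HA) cmod_real gtr0_norm// divfK// gt_eqF.
move=> pM; have : p i a <= k^-1 * p i (k%:C%C *: a).
  have {1}-> : a = (k^-1)%:C%C *: (k%:C%C *: a).
    by rewrite scalerA -rmorphM mulVf ?scale1r// gt_eqF.
  by apply: le_trans (pZ _ _ _) _; rewrite cmod_real gtr0_norm ?invr_gt0.
move=> /le_trans; apply.
have -> : `|M| / D * nrm a = k^-1 * `|M| by rewrite /k invf_div; ring.
by rewrite ler_pM2l ?invr_gt0// ltW// (lt_le_trans pM)// ler_norm.
Qed.

Definition coeff_bounded x w := exists C, forall a, cmod (phi a x w) <= C * nrm a.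

Lemma coeff_unbounded_large x w : in_l2 x -> ~ coeff_bounded x w ->
  forall D M, 0 < D -> exists a, nrm a <= D /\ M <= cmod (phi a x w).
Proof.
move=> x2 unb D M D0.
have [|||_ [a h]] := @unbounded_large unit (fun _ a => cmod (phi a x w)) _ _ _ D M D0.
- by move=> _ a; exact: cmod_ge0.
- by move=> _ k a; rewrite phiZ// cmodM.
- by move=> [C hC]; apply: unb; exists C => a; exact: hC tt a.
- by exists a.
Qed.

(** Here [v] is the source of the path, at the end of its edge list. Without sinks some edge leaves
    the range of any path and can be prepended. *)
Lemma path_ending_at v n : no_sinks s -> exists u,
  [/\ is_path r s u, size u.2 = n & last u.1 (map s u.2) = v].
Proof.
move=> ns; elim: n => [|n [[v' ps] [/= pu szu lu]]]; first by exists (v, [::]).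
have [e e_v'] := ns v'; exists (r e, e :: ps).
by split; rewrite /is_path /= ?eqxx ?szu// e_v'.
Qed.

(** Here [v] is the range. Without sources some edge e has range [v], and the induction continues at
    [s e]. *)
Lemma path_starting_at v n : no_sources r ->
  exists ps, valid_edges r s v ps /\ size ps = n.
Proof.
move=> ns; elim: n v => [|n IH] v; first by exists [::].
have [e e_v] := ns v; have [ps [val sz]] := IH (s e).
by exists (e :: ps); rewrite /= e_v eqxx sz.
Qed.

Lemma prod_neq0 (om : E -> R[i]) (ps : seq E) : (forall e, om e != 0) ->
  0 < cmod (\prod_(e <- ps) om e).
Proof.
move=> om0; rewrite lt_neqAle cmod_ge0 andbT eq_sym.
apply/eqP => /cmod_eq0/eqP; rewrite prodf_seq_eq0 => /hasP[e _].
by rewrite (negbTE (om0 e)).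
Qed.

Lemma coeff_bounded_no_sinks x w : no_sinks s -> in_l2 x -> coeff_bounded x w.
Proof.
move=> ns x2; apply: contrapT => unb.
have [b [om [om0 nb hb]]] := contractive_shift.
(* Blocks of K = |w| + 1 factors make the path p w, of length nK + |w|, shorter than (n + 1)K, so
   the terms after stage n have coefficient 0 there. *)
pose K := (size w.2).+1.
have phi_iter n a : phi (iter n (iter K (mul b)) a) x = iter (n * K) (W om) (phi a x).
  rewrite -iterM; elim: (n * K)%N => //= m IH.
  by rewrite phiM// hb; [rewrite IH | exact: phi_l2].
apply: (gliding_hump HA (iter K (mul b)) _ _ rawpath
  (fun i a => cmod (phi a x i)) (fun a => l2norm (phi a x))).
- by elim: (K) => //= m IH a a'; rewrite IH (ba_mulDr HA).
- elim: (K) => //= m IH a; apply: le_trans (ba_nrmM HA _ _) _.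
  by apply: le_trans (IH a); rewrite ler_piMl// (nrm_ge0 HA).
- by move=> i a; exact: cmod_ge0.
- by move=> i a a'; rewrite phiD// cmodD.
- by move=> i a; rewrite phiN// cmodN.
- by move=> i a; apply: cmod_le_l2norm; exact: phi_l2.
move=> n D M D0.
have [[v' ps] [/= pu szu lu]] := path_ending_at w.1 (n * K) ns.
(* W^(nK) puts a factor of modulus c in front of the coefficient; asking for M / c compensates
   it. *)
pose c := cmod (\prod_(e <- ps) om e).
have c0 : 0 < c := prod_neq0 om ps om0.
have [a [aD aM]] := coeff_unbounded_large x w x2 unb D (M / c) D0.
have tail0 (y : A) : phi (iter n.+1 (iter K (mul b)) y) x (v', ps ++ w.2) = 0.
  rewrite phi_iter iter_wshift_short//= size_cat szu mulSn /K; lia.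
exists (v', ps ++ w.2), 0, a; split;
  [exact: lexx | exact: aD | | by move=> y; rewrite mul0r tail0 cmod0].
rewrite phi_iter -szu iter_wshift_cat lu (pu : valid_edges r s v' ps) mul1r
  cmodM -/c -surjective_pairing.
by rewrite mulrC -ler_pdivrMr.
Qed.

Lemma vertex_coeff_bounded v w : no_sources r ->
  coeff_bounded (basis_vec (v, [::])) w.
Proof.
move=> ns; apply: contrapT => unb.
have l2v v' : in_l2 (basis_vec (v', [::]) : vec) by exact: (l2_basis_vec (v', [::]) _).1.
have [b [om [om0 nb hb]]] := contractive_shift.
pose K := (size w.2).+1; pose mulb a := mul a b.
have W_l2 m x : in_l2 x -> in_l2 (iter m (W om) x).
  by move=> x2; elim: m => //= m IH; rewrite -hb//; exact: phi_l2.
have phi_iter n a x : in_l2 x ->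
    phi (iter n (iter K mulb) a) x = phi a (iter (n * K) (W om) x).
  rewrite -iterM; elim: (n * K)%N x => // m IH x x2.
  by rewrite [in RHS]iterSr /= /mulb phiM// hb// IH//; exact: (W_l2 1).
(* The source of the path [ps] depends on n, so the index carries this vertex as well, and the
   dominating function is the operator norm, uniform over vertices. *)
apply: (gliding_hump HA (iter K mulb) _ _ (V * rawpath)%type
  (fun i a => cmod (phi a (basis_vec (i.1, [::])) i.2)) (fun a => opnorm r s (phi a))).
- by elim: (K) => //= m IH a a'; rewrite IH /mulb (ba_mulDl HA).
- elim: (K) => //= m IH a; apply: le_trans (ba_nrmM HA (iter m mulb a) b) _.
  by apply: le_trans (IH a); rewrite ler_piMr// (nrm_ge0 HA).
- by move=> i a; exact: cmod_ge0.
- by move=> i a a'; rewrite phiD// cmodD.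
- by move=> i a; rewrite phiN// cmodN.
- move=> [v' w'] a /=.
  apply: le_trans (cmod_le_l2norm _ w' (phi_l2 a _ (l2v v'))) _.
  by apply: le_opnorm (phi_bounded a) (l2v v') _;
  exact: (@l2_basis_vec R V E r s (v', [::]) _).2.
move=> n D M D0.
have [ps [val szps]] := path_starting_at v (n * K) ns.
pose c := cmod (\prod_(e <- ps) om e).
have c0 : 0 < c := prod_neq0 om ps om0.
have [a [aD aM]] := coeff_unbounded_large _ w (l2v v) unb D (M / c) D0.
(* W^((n+1)K) sends a vertex vector to paths of length at least (n+1)K, a prepend-closed set, so
   [phi y] cannot reach the shorter path w ps. *)
have tail0 (y : A) : phi (iter n.+1 (iter K mulb) y)
    (basis_vec (last v (map s ps), [::])) (w.1, w.2 ++ ps) = 0.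
  rewrite phi_iter// (Tplus_supp (fun u => (n.+1 * K <= size u.2)%N) _ _ _ (Hsurj.1 y))//.
  + by move=> e es /=; exact: leqW.
  + exact: W_l2.
  + by move=> u /negP; rewrite -ltnNge; exact: iter_wshift_short.
  + by apply/negP; rewrite size_cat szps mulSn /K; lia.
exists (last v (map s ps), (w.1, w.2 ++ ps)), 0, a; split;
  [exact: lexx | exact: aD | | by move=> y; rewrite mul0r tail0 cmod0].
rewrite phi_iter//= -szps.
set x := iter _ _ _.
have x2 : in_l2 x by exact: W_l2.
rewrite -(Tplus_strip (phi a) ps x (Hsurj.1 a) x2); last first.
  by move=> u; exact: iter_wshift_short.
(* Among the paths of length nK that make up [x], only [ps] itself survives the deletion of [ps]; it
   leaves the vertex v with the product of its weights. *)
have -> : strip ps x = (fun u => (\prod_(e <- ps) om e) * basis_vec (v, [::]) u).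
  apply/funext => -[v0 [|f es]]; rewrite /strip /= /x.
    rewrite -[X in (v0, X)]cats0 iter_wshift_cat /basis_vec !xpair_eqE !andbT.
    have [->|nv] := eqVneq v0 v; first by rewrite val eqxx mul1r.
    case: (ps) val => [|e ps'] /=; first by rewrite (negbTE nv) !mulr0.
    by move=> /andP[/eqP -> _]; rewrite eq_sym (negbTE nv) /= !mul0r mulr0.
  rewrite -[f :: (es ++ ps)](cat_take_drop (size ps)).
  have sz : size (take (size ps) (f :: (es ++ ps))) = size ps.
    by rewrite size_takel//= size_cat; lia.
  rewrite -[X in iter X]sz iter_wshift_cat /basis_vec !xpair_eqE /= andbF mulr0.
  case dr : (drop _ _) => [|g gs]; last by rewrite andbF mulr0.
  by have := congr1 size dr; rewrite size_drop /= size_cat; lia.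
rewrite (bounded_opZ (phi a) _ _ (phi_bounded a) (l2v v)).
by rewrite cmodM -/c mulrC -ler_pdivrMr.
Qed.

(** Deleting u turns xi_u into the vector of its range vertex, so the coefficient of phi(a) xi_u at
    fs u is that of phi(a) xi_{r(u)} at fs. If the edge list of w does not end in that of u, the
    coefficient is 0. *)
Lemma basis_coeff_bounded u w : no_sources r -> is_path r s u ->
  coeff_bounded (basis_vec u) w.
Proof.
move=> ns pu; have [u2 _] := @l2_basis_vec R V E r s u pu.
have [[fs wE]|nw] := pselect (exists fs, w.2 = fs ++ u.2).
  have [C hC] := vertex_coeff_bounded u.1 (w.1, fs) ns; exists C => a.
  apply: le_trans _ (hC a).
  have <- : strip u.2 (basis_vec u) = basis_vec (u.1, [::]) :> vec.
    apply/funext => -[v es]; rewrite /strip /basis_vec /= [in LHS](surjective_pairing u).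
    rewrite !xpair_eqE /= -[X in _ && (_ == X)]cat0s; congr ((_ && _)%:R).
    apply/eqP/eqP => [e|->//]; have := congr1 size e; rewrite !size_cat => h.
    by apply/nilP/eqP; move: h => /=; lia.
  rewrite (Tplus_strip _ _ _ (Hsurj.1 a))//= -?wE -?surjective_pairing//.
  by move=> v; rewrite /basis_vec; case: eqP => // ->; rewrite ltnn.
exists 0 => a; rewrite mul0r.
rewrite (Tplus_supp (fun w => exists fs, w.2 = fs ++ u.2) _ _ _ (Hsurj.1 a) u2)//.
- by rewrite cmod0.
- by move=> e es /= [fs ->]; exists (e :: fs).
- move=> v nv; rewrite /basis_vec; case: eqP => // vu; case: nv.
  by exists [::]; rewrite vu.
Qed.

(** The tails of a path, left after removing leading edges. By [subpaths_tail] their complement is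
    prepend-closed, so the coefficient of phi(a) x at w depends only on the values of x on the tails
    of w. *)
Fixpoint subpaths (v : V) (es : seq E) : seq rawpath :=
  (v, es) :: if es is e :: es' then subpaths (s e) es' else [::].

Lemma subpaths_tail v l e es :
  (r e, e :: es) \in subpaths v l -> (s e, es) \in subpaths v l.
Proof.
elim: l v => [|f l IH] v /=; first by rewrite inE xpair_eqE andbF.
rewrite inE => /orP[/eqP[_ -> ->]|/IH h]; rewrite inE; last by rewrite h orbT.
by case: (l) => [|? ?]; rewrite /= inE eqxx orbT.
Qed.

Lemma coeff_bounded_no_sources x w : no_sources r -> in_l2 x -> coeff_bounded x w.
Proof.
(* Induction on a list [l] outside which x vanishes on the tails of w; each step splits off one
   basis vector. *)
move=> ns; suff h (l : seq rawpath) : forall x, in_l2 x ->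
    (forall u, u \in subpaths w.1 w.2 -> u \notin l -> x u = 0) -> coeff_bounded x w.
  by move=> x2; apply: (h (subpaths w.1 w.2) x x2) => u ->.
elim: l => [|u l IH] {}x x2 xl.
  exists 0 => a; rewrite mul0r.
  rewrite (Tplus_supp (fun u => u \notin subpaths w.1 w.2) _ _ _ (Hsurj.1 a) x2).
  - by rewrite cmod0.
  - by move=> e es; apply: contra; exact: subpaths_tail.
  - by move=> u /negP; rewrite negbK => us; exact: xl.
  - by apply/negP; rewrite negbK; case: (w) => v [|? ?]; rewrite /= inE eqxx.
(* Off genuine paths x already vanishes, and [basis_vec u] would violate [in_l2]. *)
have [pu|npu] := boolP (is_path r s u); last first.
  apply: IH => // u' us nl; have [->|nu] := eqVneq u' u; first exact: x2.1.
  by apply: xl => //; rewrite inE negb_or nu.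
have [u2 _] := @l2_basis_vec R V E r s u pu.
pose x' := restr (fun u' => u' != u) x.
have [x'2 _] := l2_restr (fun u' => u' != u) x x2.
have [C hC] := basis_coeff_bounded u w ns pu.
have [|C' hC'] := IH x' x'2.
  move=> u' us nl; rewrite /x' /restr; case: ifP => // nu.
  by apply: xl => //; rewrite inE negb_or nu.
exists (cmod (x u) * C + C') => a.
have {1}-> : x = (fun u' => x u * basis_vec u u' + x' u').
  apply/funext => u'; rewrite /basis_vec /x' /restr.
  by case: eqVneq => [->|_]; rewrite ?mulr1 ?mulr0 ?addr0 ?add0r.
rewrite (phi_bounded a).2.1//; apply: le_trans (cmodD _ _) _.
rewrite mulrDl lerD// cmodM -mulrA ler_wpM2l ?cmod_ge0//.
Qed.

(** A crude l1 bound: it turns bounds on single coefficients into a bound, depending on [F], for the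
    restriction to [F]. *)
Lemma l2norm_restr_seq x : in_l2 x -> forall F : seq rawpath,
  l2norm (restr (mem F) x) <= \sum_(w <- F) cmod (x w).
Proof.
move=> x2; elim=> [|u F IH].
  by rewrite big_nil (_ : restr _ x = fun _ => 0) ?(@l2_zero R V E r s).2//; apply/funext.
rewrite big_cons.
have [uF|nuF] := boolP (u \in F).
  have -> : restr (mem (u :: F)) x = restr (mem F) x.
    apply/funext => w; rewrite /restr /= inE.
    by case: eqP => //= ->; rewrite uF.
  by apply: le_trans IH _; rewrite lerDr cmod_ge0.
have -> : restr (mem (u :: F)) x =
    (fun w => restr (pred1 u) x w + restr (mem F) x w).
  apply/funext => w; rewrite /restr /= inE.
  by case: eqP => /= [->|_]; rewrite ?(negbTE nuF) ?addr0 ?add0r.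
apply: le_trans (l2_add _ _ (l2_restr _ _ x2).1 (l2_restr _ _ x2).1).2 _.
rewrite lerD//; apply: l2norm_le (cmod_ge0 _) _ => G uG.
have := sum_single_le u (restr (pred1 u) x) G _ uG.
by rewrite /restr /= eqxx; apply=> w /negbTE ->.
Qed.

(* Uniform boundedness: the gliding hump with [sigma] the identity. *)
Lemma opnorm_phi_bounded : (forall x w, in_l2 x -> coeff_bounded x w) ->
  exists2 M, 0 <= M & forall a x, in_l2 x -> l2norm x <= 1 ->
    l2norm (phi a x) <= M * nrm a.
Proof.
move=> cb.
(* An index is a vector of the unit ball with a finite list of paths. Restriction to the list makes
   each [p i] bounded on A, and the supremum over all lists recovers the full norm. *)
pose I := {i : vec * seq rawpath | in_l2 i.1 /\ l2norm i.1 <= 1}.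
pose p (i : I) a := l2norm (restr (mem (sval i).2) (phi a (sval i).1)).
have p0 i a : 0 <= p i a by exact: l2norm_ge0.
have pZ i (k : R[i]) a : p i (k *: a) <= cmod k * p i a.
  case: i => -[x F] [/= x2 x1]; rewrite /p /= phiZ//.
  have -> : restr (mem F) (fun w => k * phi a x w) =
      (fun w => k * restr (mem F) (phi a x) w).
    by apply/funext => w; rewrite /restr; case: ifP; rewrite ?mulr0.
  exact: (l2_scale _ _ (l2_restr _ _ (phi_l2 _ _ x2)).1).2.
have [[C hC]|unb] := pselect (exists C, forall i a, p i a <= C * nrm a).
  exists `|C| => // a x x2 x1; apply: l2norm_le => [|F uF].
    by rewrite mulr_ge0// (nrm_ge0 HA).
  have [rx2 _] := l2_restr (mem F) _ (phi_l2 a x x2).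
  apply: (@le_trans _ _ (l2norm (restr (mem F) (phi a x)) ^+ 2)).
    apply: le_trans (sum_le_l2norm _ F rx2 uF).
    by rewrite big_seq [leRHS]big_seq; apply: ler_sum => w wF; rewrite /restr /= wF.
  have := hC (exist _ (x, F) (conj x2 x1)) a; rewrite /p /= => h.
  rewrite ler_sqr ?nnegrE ?l2norm_ge0 ?mulr_ge0 ?(nrm_ge0 HA)//.
  by apply: le_trans h _; rewrite ler_wpM2r ?(nrm_ge0 HA)// ler_norm.
exfalso; apply: (gliding_hump HA id _ _ I p (fun a => opnorm r s (phi a))) => //.
- case=> -[x F] [/= x2 x1] a b; rewrite /p /= phiD//.
  have -> : restr (mem F) (fun w => phi a x w + phi b x w) =
      (fun w => restr (mem F) (phi a x) w + restr (mem F) (phi b x) w).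
    by apply/funext => w; rewrite /restr; case: ifP; rewrite ?addr0.
  apply: (l2_add _ _ _ _).2; exact: (l2_restr _ _ (phi_l2 _ _ x2)).1.
- by move=> i a; rewrite -scaleN1r; apply: le_trans (pZ _ _ _) _; rewrite cmodN cmod1 mul1r.
- case=> -[x F] [/= x2 x1] a; rewrite /p /=.
  apply: le_trans (l2_restr _ _ (phi_l2 _ _ x2)).2 _.
  exact: le_opnorm (phi_bounded a) x2 x1.
have iter_id n (a : A) : iter n id a = a by elim: n.
move=> n D M D0; have [i [a [aD aM]]] := unbounded_large I p p0 pZ unb D M D0.
suff [C [C0 hC]] : exists C, 0 <= C /\ forall y : A, p i y <= C * nrm y.
  by exists i, C, a; rewrite iter_id; split=> // y; rewrite iter_id.
case: i {aM} => -[x F] [/= x2 x1]; rewrite /p /=.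
have [C hC] := choice (fun w => cb x w x2).
(* Absolute values, since nothing fixes the sign of [C w]. *)
exists (\sum_(w <- F) `|C w|); split; first by rewrite sumr_ge0.
move=> y; apply: le_trans (l2norm_restr_seq _ (phi_l2 y x x2) F) _.
rewrite mulr_suml; apply: ler_sum => w _; apply: le_trans (hC w y) _.
by rewrite ler_wpM2r ?(nrm_ge0 HA)// ler_norm.
Qed.

End AutomaticContinuity.

Theorem theorem2p11 (R : realType) (V E : countType) (r s : E -> V)
  (HG : no_sinks s \/ no_sources r)
  (A : lmodType R[i]) (mul : A -> A -> A) (nrm : A -> R)
  (HA : banach_algebra mul nrm)
  (phi : A -> op R V E)
  (Hhom : alg_hom_op r s mul phi)
  (Hsurj : onto_Tplus r s phi) :
  forall a0 : A, forall eps : R, 0 < eps -> exists delta : R, 0 < delta /\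
    forall a : A, nrm (a - a0) < delta -> opnorm r s (opsub (phi a) (phi a0)) < eps.
Proof.
have cb x w : in_l2 r s x -> coeff_bounded (nrm := nrm) (phi := phi) x w.
  case: HG => ns x2; first exact: (coeff_bounded_no_sinks HA Hhom Hsurj).
  exact: (coeff_bounded_no_sources HA Hhom Hsurj).
have [M M0 hM] := opnorm_phi_bounded HA Hhom Hsurj cb.
(* The summand 1 covers the case M = 0. *)
move=> a0 eps eps0; exists (eps / (M + 1)).
have M1 : 0 < M + 1 by lra.
split=> [|a ha]; first by rewrite divr_gt0.
apply: (@le_lt_trans _ _ (M * nrm (a - a0))).
  apply: opnorm_le => x x2 x1; apply: le_trans (hM (a - a0) x x2 x1).
  by rewrite (phiD Hhom _ (- a0) x x2) (phiN Hhom a0 x x2).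
move: ha; rewrite ltr_pdivlMr//; have := nrm_ge0 HA (a - a0).
by set t := nrm _; lra.
Qed.
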